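(* For every $r\in(0,1)$, with $r'=\sqrt{1-r^{2}}$, the infinite product $P(r)=\prod_{n=0}^{\infty}(1+r_{n})^{2^{-n}}$ built from the ascending Landen sequence $(r_n)_{n\ge 0}$ of $r$ satisfies $$P(r)=r'\,e^{\mu(r')}.$$ Consequently the function $G(r):=\log r+\mu(r)+\log P(r)$, $r\in(0,1)$, is symmetric in $r$ and $r'$: for every $r\in(0,1)$, $$G(r)=\log(rr')+\mu(r)+\mu(r')=G(r').$$
   Context: For $r\in(0,1)$ write $r'=\sqrt{1-r^{2}}\in(0,1)$. The complete elliptic integral of the first kind is $$\mathcal{K}(r)=\int_{0}^{\pi/2}\frac{dt}{\sqrt{1-r^{2}\sin^{2}t}},\qquad r\in(0,1),$$ where $r$ is the modulus (so $r^2$ is the parameter). The Grötzsch ring function $\mu:(0,1)\to(0,\infty)$ is $$\mu(r)=\frac{\pi}{2}\,\frac{\mathcal{K}(r')}{\mathcal{K}(r)}.$$ The ascending Landen sequence of $r\in(0,1)$ is defined by $r_{0}=r$ and $$r_{n+1}=\frac{2\sqrt{r_{n}}}{1+r_{n}},\qquad n=0,1,2,\dots$$ The convergent infinite product $P$ is $$P(r)=\prod_{n=0}^{\infty}\bigl(1+r_{n}\bigr)^{2^{-n}},\qquad r\in(0,1).$$ Here $P(r')$ (appearing in $G(r')$) is formed from the Landen sequence started at $r'$. All logarithms are real natural logarithms. *)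

(* Defs.v *)
From Stdlib Require Import Reals.
From Coquelicot Require Import Coquelicot.
Open Scope R_scope.

Definition conj_mod (r : R) : R := sqrt (1 - r ^ 2).

(* [r] is the modulus, so the parameter is [r ^ 2]. *)
Definition ellK (r : R) : R :=
  RInt (fun t => 1 / sqrt (1 - r ^ 2 * sin t ^ 2)) 0 (PI / 2).

Definition mu (r : R) : R := PI / 2 * (ellK (conj_mod r) / ellK r).

Fixpoint landen (r : R) (n : nat) : R :=
  match n with
  | O => r
  | S m => 2 * sqrt (landen r m) / (1 + landen r m)
  end.

(* [prod_f_R0 f N] has the N + 1 factors f 0, ..., f N. *)
Definition landen_partial (r : R) (N : nat) : R :=
  prod_f_R0 (fun n => Rpower (1 + landen r n) (/ 2 ^ n)) N.

(* [Lim_seq] is total with values in [Rbar]; [landen_prod r] is the value of the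
   infinite product only when [ex_finite_lim_seq (landen_partial r)] holds. *)
Definition landen_prod (r : R) : R := real (Lim_seq (landen_partial r)).

Definition G (r : R) : R := ln r + mu r + ln (landen_prod r).

(* Main.v *)
(* With [s_n] the conjugate of [r_n], one has [s_(n+1) * (1 + r_n) ^ 2 = s_n ^ 2],
   so the partial products telescope to [r' * exp (- ln s_N / 2 ^ N)].  Landen's
   transformation of [ellK] gives [mu s_N = 2 ^ N * mu r'].  Since
   [sin t <= 1 <= sin t + sqrt (1 - k ^ 2 * sin t ^ 2) / k], comparing [ellK k]
   with an elementary integral yields [mu s ~ - ln s] as [s] tends to [0];
   as [s_N] tends to [0], [- ln s_N / 2 ^ N] tends to [mu r']. *)

Require Import Defs.
From Stdlib Require Import Reals Lra.
From Coquelicot Require Import Coquelicot.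
Open Scope R_scope.

(** * The integrand of the complete elliptic integral *)

Lemma delta_sq_pos k t : 0 < k < 1 -> 0 < 1 - k ^ 2 * sin t ^ 2.
Proof.
  intros hk.
  pose proof (sin2_cos2 t) as h; unfold Rsqr in h.
  assert (h1 : 0 <= cos t * cos t) by apply Rle_0_sqr.
  assert (h2 : 0 <= sin t * sin t) by apply Rle_0_sqr.
  nra.
Qed.

Lemma delta_pos k t : 0 < k < 1 -> 0 < sqrt (1 - k ^ 2 * sin t ^ 2).
Proof. intros hk; now apply sqrt_lt_R0, delta_sq_pos. Qed.

Lemma delta_sq k t : 0 < k < 1 ->
  sqrt (1 - k ^ 2 * sin t ^ 2) ^ 2 = 1 - k ^ 2 * sin t ^ 2.
Proof. intros hk; apply pow2_sqrt, Rlt_le, delta_sq_pos, hk. Qed.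

(** The square of the root exceeds [(k * cos t) ^ 2] by [1 - k ^ 2 > 0], so the root dominates even
    where [cos t < 0]. *)
Lemma delta_add_cos_pos k t : 0 < k < 1 ->
  0 < k * cos t + sqrt (1 - k ^ 2 * sin t ^ 2).
Proof.
  intros hk.
  pose proof (delta_pos k t hk) as hd.
  pose proof (delta_sq k t hk) as hd2.
  pose proof (sin2_cos2 t) as h; unfold Rsqr in h.
  nra.
Qed.

Lemma continuous_ellK_integrand k t : 0 < k < 1 ->
  continuous (fun t => 1 / sqrt (1 - k ^ 2 * sin t ^ 2)) t.
Proof.
  intros hk; apply (@ex_derive_continuous R_AbsRing R_NormedModule).
  pose proof (delta_sq_pos k t hk); pose proof (delta_pos k t hk).
  auto_derive; unfold Rminus in *; simpl in *; repeat split; lra.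
Qed.

Lemma ex_RInt_ellK_integrand k a b : 0 < k < 1 ->
  ex_RInt (fun t => 1 / sqrt (1 - k ^ 2 * sin t ^ 2)) a b.
Proof.
  intros hk; apply (@ex_RInt_continuous R_CompleteNormedModule).
  intros t _; now apply continuous_ellK_integrand.
Qed.

(** By the reflection [t -> PI - t]. The full range [[0, PI]] is the one on which Landen's
    substitution is made. *)
Lemma RInt_ellK_integrand_0_PI k : 0 < k < 1 ->
  RInt (fun t => 1 / sqrt (1 - k ^ 2 * sin t ^ 2)) 0 PI = 2 * ellK k.
Proof.
  intros hk.
  rewrite <- (RInt_Chasles _ 0 (PI / 2) PI)
    by (now apply ex_RInt_ellK_integrand).
  fold (ellK k).
  assert (h : RInt (fun t => 1 / sqrt (1 - k ^ 2 * sin t ^ 2)) (PI / 2) PI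
              = ellK k); [| rewrite h; unfold plus; simpl; ring].
  unfold ellK.
  rewrite <- (opp_RInt_swap _ PI (PI / 2))
    by (now apply ex_RInt_ellK_integrand).
  replace PI with (-1 * 0 + PI) at 1 by ring.
  replace (PI / 2) with (-1 * (PI / 2) + PI) at 1 by field.
  rewrite <- (RInt_comp_lin _ (-1) PI 0 (PI / 2))
    by (now apply ex_RInt_ellK_integrand).
  rewrite <- RInt_opp.
  - apply RInt_ext; intros t _.
    replace (-1 * t + PI) with (PI - t) by ring.
    rewrite sin_PI_x; unfold opp, scal; simpl; unfold mult; simpl; ring.
  - apply ex_RInt_ext with
      (fun t => opp (1 / sqrt (1 - k ^ 2 * sin t ^ 2))).
    + intros t _; replace (-1 * t + PI) with (PI - t) by ring.
      rewrite sin_PI_x; unfold opp, scal; simpl; unfold mult; simpl; ring.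
    + apply (@ex_RInt_opp R_NormedModule); now apply ex_RInt_ellK_integrand.
Qed.

(** * Landen's ascending transformation *)

Lemma landen_step_bounds k : 0 < k < 1 ->
  0 < 2 * sqrt k / (1 + k) < 1.
Proof.
  intros hk.
  assert (h : 0 < sqrt k) by (apply sqrt_lt_R0; lra).
  pose proof (sqrt_sqrt k ltac:(lra)) as h2.
  split; [apply Rdiv_lt_0_compat; lra |].
  apply Rlt_div_l; [lra | nra].
Qed.

(** The function is the explicit solution [theta] of [sin (2 * theta - x) = k * sin x]; [asin] is
    differentiable here because [|k * sin x| < 1]. *)
Lemma is_derive_landen_angle k x : 0 < k < 1 ->
  is_derive (fun x => (x + asin (k * sin x)) / 2) x
    ((1 + k * cos x / sqrt (1 - k ^ 2 * sin x ^ 2)) / 2).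
Proof.
  intros hk.
  assert (hb : -1 < k * sin x < 1) by (pose proof (SIN_bound x); nra).
  pose proof (delta_pos k x hk) as hd.
  apply (is_derive_ext (fun x => scal (/ 2) (plus x (asin (k * sin x))))).
  { intros t; unfold scal, plus; simpl; unfold mult; simpl; field. }
  evar_last.
  - apply is_derive_scal, (@is_derive_plus R_AbsRing R_NormedModule).
    + apply is_derive_id.
    + apply (is_derive_comp asin (fun x => k * sin x)).
      * apply is_derive_Reals, (derive_pt_eq_1 _ _ _ _ (derive_pt_asin _ hb)).
      * auto_derive; [exact I | reflexivity].
  - unfold scal, plus, one; simpl; unfold mult; simpl.
    replace (1 - (k * sin x)²) with (1 - k * (k * 1) * (sin x * (sin x * 1)))
      by (unfold Rsqr; ring).
    simpl in hd; field; lra.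
Qed.

(* The substitution [sin (2 * theta - phi) = k * sin phi] carries [0, PI] onto
   [0, PI / 2] and, unlike the one based on [sin theta], is smooth up to the
   end points because [k < 1]. *)
Lemma ellK_landen k : 0 < k < 1 ->
  ellK (2 * sqrt k / (1 + k)) = (1 + k) * ellK k.
Proof.
  intros hk.
  set (l := 2 * sqrt k / (1 + k)).
  assert (hl : 0 < l < 1) by now apply landen_step_bounds.
  assert (hl2 : l ^ 2 = 4 * k / (1 + k) ^ 2).
  { unfold l; unfold Rdiv; rewrite !Rpow_mult_distr, pow2_sqrt by lra.
    field; lra. }
  set (th := fun x => (x + asin (k * sin x)) / 2).
  set (dth := fun x => (1 + k * cos x / sqrt (1 - k ^ 2 * sin x ^ 2)) / 2).
  assert (h0 : th 0 = 0) by (unfold th; rewrite sin_0, Rmult_0_r, asin_0; field).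
  assert (h1 : th PI = PI / 2)
    by (unfold th; rewrite sin_PI, Rmult_0_r, asin_0; field).
  unfold ellK at 1; rewrite <- h1, <- h0.
  rewrite <- (RInt_comp _ th dth).
  (* The pulled-back integrand is [(1 + k) / 2] times the one of modulus [k]; the half is absorbed
     by the integral over [[0, PI]], which is [2 * ellK k]. *)
  - rewrite (RInt_ext _ (fun t => @scal _ R_CompleteNormedModule ((1 + k) / 2)
                           (1 / sqrt (1 - k ^ 2 * sin t ^ 2)))).
    + rewrite (@RInt_scal R_CompleteNormedModule), RInt_ellK_integrand_0_PI
        by (auto; now apply ex_RInt_ellK_integrand).
      unfold scal; simpl; unfold mult; simpl; field.
    + intros x _.
      pose proof (delta_pos k x hk) as hd.
      pose proof (delta_sq k x hk) as hd2.
      pose proof (delta_add_cos_pos k x hk) as hc.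
      assert (hb : -1 <= k * sin x <= 1) by (pose proof (SIN_bound x); nra).
      assert (e : 1 - l ^ 2 * sin (th x) ^ 2 =
        ((k * cos x + sqrt (1 - k ^ 2 * sin x ^ 2)) / (1 + k)) ^ 2).
      (* Doubling the angle removes the half in [th], leaving the cosine of
         [x + asin (k * sin x)]. *)
      { assert (e2 : 1 - 2 * sin (th x) ^ 2
                    = cos x * sqrt (1 - k ^ 2 * sin x ^ 2) - k * sin x ^ 2).
        { transitivity (cos (2 * th x)); [rewrite cos_2a_sin; ring |].
          unfold th; replace (2 * ((x + asin (k * sin x)) / 2))
            with (x + asin (k * sin x)) by field.
          rewrite cos_plus, cos_asin, sin_asin by lra.
          replace (1 - (k * sin x)²) with (1 - k ^ 2 * sin x ^ 2)
            by (unfold Rsqr; ring).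
          ring. }
        replace (sin (th x) ^ 2) with
          ((1 - (cos x * sqrt (1 - k ^ 2 * sin x ^ 2) - k * sin x ^ 2)) / 2)
          by lra.
        rewrite hl2.
        pose proof (sin2_cos2 x) as hs; unfold Rsqr in hs.
        set (D := sqrt (1 - k ^ 2 * sin x ^ 2)) in *.
        replace (((k * cos x + D) / (1 + k)) ^ 2) with
          ((k ^ 2 * (1 - sin x ^ 2) + 2 * k * cos x * D + D ^ 2) / (1 + k) ^ 2).
        - rewrite hd2; field; lra.
        - replace (1 - sin x ^ 2) with (cos x ^ 2) by (simpl; lra).
          field; lra. }
      (* Positivity of [k * cos x + sqrt (1 - k ^ 2 * sin x ^ 2)] fixes the sign of the root; the
         same sum is the numerator of [dth] and cancels. *)
      rewrite e, sqrt_pow2 by (apply Rlt_le, Rdiv_lt_0_compat; lra).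
      unfold dth, scal; simpl; unfold mult; simpl.
      simpl in hd, hc; field; lra.
  - intros x _; now apply continuous_ellK_integrand.
  - intros x _; split; [now apply is_derive_landen_angle |].
    apply (@ex_derive_continuous R_AbsRing R_NormedModule).
    pose proof (delta_sq_pos k x hk); pose proof (delta_pos k x hk).
    unfold dth; auto_derive; unfold Rminus in *; simpl in *; repeat split; lra.
Qed.

(** * Conjugate moduli and the descending transformation *)

Lemma conj_mod_bounds k : 0 < k < 1 -> 0 < conj_mod k < 1.
Proof.
  intros hk; unfold conj_mod; split; [apply sqrt_lt_R0; nra |].
  rewrite <- sqrt_1 at 2; apply sqrt_lt_1; nra.
Qed.

Lemma conj_mod_sq k : 0 < k < 1 -> conj_mod k ^ 2 = 1 - k ^ 2.
Proof. intros hk; apply pow2_sqrt; nra. Qed.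

Lemma conj_mod_involutive k : 0 < k < 1 -> conj_mod (conj_mod k) = k.
Proof.
  intros hk; unfold conj_mod at 1; rewrite conj_mod_sq by auto.
  replace (1 - (1 - k ^ 2)) with (k ^ 2) by ring.
  apply sqrt_pow2; lra.
Qed.

Lemma conj_mod_landen_step k : 0 < k < 1 ->
  conj_mod (2 * sqrt k / (1 + k)) = (1 - k) / (1 + k).
Proof.
  intros hk; unfold conj_mod.
  replace (1 - (2 * sqrt k / (1 + k)) ^ 2) with (((1 - k) / (1 + k)) ^ 2).
  - apply sqrt_pow2, Rlt_le, Rdiv_lt_0_compat; lra.
  - unfold Rdiv; rewrite !Rpow_mult_distr, pow2_sqrt by lra.
    field; lra.
Qed.

(** This is [ellK_landen] at the modulus [(1 - k) / (1 + k)], whose Landen image is [conj_mod k]. *)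
Lemma ellK_conj_landen k : 0 < k < 1 ->
  ellK (conj_mod k) = 2 / (1 + k) * ellK ((1 - k) / (1 + k)).
Proof.
  intros hk.
  assert (hx : 0 < (1 - k) / (1 + k) < 1).
  { rewrite <- conj_mod_landen_step by auto.
    now apply conj_mod_bounds, landen_step_bounds. }
  pose proof (ellK_landen _ hx) as h.
  replace (1 + (1 - k) / (1 + k)) with (2 / (1 + k)) in h by (field; lra).
  rewrite <- h; f_equal.
  assert (hy : 0 < 2 * sqrt ((1 - k) / (1 + k)) / (2 / (1 + k))).
  { apply Rdiv_lt_0_compat; [| apply Rdiv_lt_0_compat; lra].
    apply Rmult_lt_0_compat; [lra | now apply sqrt_lt_R0]. }
  (* Both moduli are now square roots, so only the radicands need comparing. *)
  rewrite <- (sqrt_pow2 (2 * _ / _)) by lra.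
  unfold conj_mod; f_equal.
  unfold Rdiv; rewrite !Rpow_mult_distr, pow2_sqrt by (unfold Rdiv in hx; lra).
  field; lra.
Qed.

(** * Elementary estimates of the elliptic integral *)

(** The integrand lies between [1] and [/ conj_mod k]. Applied to the conjugate modulus, this pins
    [ellK (conj_mod k)] to [PI / 2] as [k] tends to [1]. *)
Lemma ellK_bounds k : 0 < k < 1 -> PI / 2 <= ellK k <= PI / 2 / conj_mod k.
Proof.
  intros hk.
  pose proof PI_RGT_0 as hpi.
  pose proof (conj_mod_bounds k hk) as hc.
  pose proof (conj_mod_sq k hk) as hc2.
  assert (hcst : forall c, RInt (fun _ : R => c) 0 (PI / 2) = PI / 2 * c).
  { intros c; rewrite RInt_const; unfold scal; simpl; unfold mult; simpl; ring. }
  change (PI / 2 / conj_mod k) with (PI / 2 * / conj_mod k).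
  rewrite <- (Rmult_1_r (PI / 2)) at 1; rewrite <- !hcst.
  split; (apply RInt_le;
    [lra | try apply ex_RInt_const; now apply ex_RInt_ellK_integrand
         | try apply ex_RInt_const; now apply ex_RInt_ellK_integrand |]);
    intros t _;
    pose proof (delta_pos k t hk) as hd;
    pose proof (delta_sq k t hk) as hd2;
    pose proof (SIN_bound t) as hs.
  - apply Rle_div_r; [lra | nra].
  - unfold Rdiv; rewrite Rmult_1_l; apply Rinv_le_contravar; [lra |].
    assert (sin t ^ 2 <= 1) by nra.
    apply Rsqr_incr_0_var; [unfold Rsqr; nra | lra].
Qed.

(** The antiderivative is [F] below; the argument of its logarithm is [1 + k] at [0] and
    [conj_mod k] at [PI / 2]. *)
Lemma is_RInt_sin_div_delta k : 0 < k < 1 ->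
  is_RInt (fun t => sin t / sqrt (1 - k ^ 2 * sin t ^ 2)) 0 (PI / 2)
    (ln ((1 + k) / conj_mod k) / k).
Proof.
  intros hk.
  pose proof (conj_mod_bounds k hk) as hc.
  set (F := fun t => - ln (k * cos t + sqrt (1 - k ^ 2 * sin t ^ 2)) / k).
  replace (ln ((1 + k) / conj_mod k) / k) with (minus (F (PI / 2)) (F 0)).
  - apply (is_RInt_derive F).
    + intros t _.
      pose proof (delta_sq_pos k t hk) as hp.
      pose proof (delta_pos k t hk) as hd.
      pose proof (delta_add_cos_pos k t hk) as hs.
      unfold F; auto_derive; unfold Rminus in *; simpl in *.
      * repeat split; lra.
      * field; lra.
    + intros t _; apply (@ex_derive_continuous R_AbsRing R_NormedModule).
      pose proof (delta_sq_pos k t hk); pose proof (delta_pos k t hk).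
      auto_derive; unfold Rminus in *; simpl in *; repeat split; lra.
  - unfold F, minus, plus, opp; simpl.
    rewrite cos_PI2, sin_PI2, cos_0, sin_0, ln_div by lra.
    unfold conj_mod; simpl.
    replace (1 - k * (k * 1) * (0 * (0 * 1))) with 1 by ring.
    replace (1 - k * (k * 1) * (1 * (1 * 1))) with (1 - k * (k * 1)) by ring.
    rewrite sqrt_1, Rmult_0_r, Rplus_0_l, Rmult_1_r, (Rplus_comm k 1).
    field; lra.
Qed.

(** The integrand lies between [sin t / D] and [sin t / D + / k], with [D] the root; integrating the
    constant [/ k] gives the gap [PI / 2 / k]. *)
Lemma ellK_log_bounds k : 0 < k < 1 ->
  ln ((1 + k) / conj_mod k) / k <= ellK k
  <= ln ((1 + k) / conj_mod k) / k + PI / 2 / k.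
Proof.
  intros hk.
  pose proof PI_RGT_0 as hpi.
  assert (h02 : 0 <= PI / 2) by lra.
  pose proof (is_RInt_sin_div_delta k hk) as hI.
  assert (hJ : is_RInt (fun t => plus (sin t / sqrt (1 - k ^ 2 * sin t ^ 2)) (/ k))
            0 (PI / 2) (ln ((1 + k) / conj_mod k) / k + PI / 2 / k)).
  { apply (@is_RInt_plus R_NormedModule); [exact hI |].
    replace (PI / 2 / k) with (scal (PI / 2 - 0) (/ k))
      by (unfold scal; simpl; unfold mult; simpl; field; lra).
    apply (@is_RInt_const R_NormedModule). }
  pose proof (@RInt_correct R_CompleteNormedModule _ _ _
    (ex_RInt_ellK_integrand k 0 (PI / 2) hk)) as hK.
  fold (ellK k) in hK.
  split; [apply (is_RInt_le _ _ _ _ _ _ h02 hI hK)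
         | apply (is_RInt_le _ _ _ _ _ _ h02 hK hJ)];
    intros t ht;
    pose proof (delta_pos k t hk) as hd;
    pose proof (delta_sq k t hk) as hd2;
    pose proof (SIN_bound t) as hs.
  - unfold Rdiv; apply Rmult_le_compat_r; [apply Rlt_le, Rinv_0_lt_compat|]; lra.
  - assert (h0 : 0 < sin t) by (apply sin_gt_0; lra).
    unfold plus; simpl.
    (* Squared, this says [k ^ 2 - 2 * k ^ 2 * sin t * (1 - sin t) <= 1], true because
       [0 < sin t <= 1] and [k < 1]. *)
    assert (h : k * (1 - sin t) <= sqrt (1 - k ^ 2 * sin t ^ 2)).
    { apply Rsqr_incr_0_var; [| lra]. unfold Rsqr.
      assert (k * k <= 1) by nra.
      assert (0 <= sin t * (1 - sin t)) by nra.
      nra. }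
    simpl in *.
    set (D := sqrt _) in *.
    apply Rminus_le_0.
    replace (sin t / D + / k - 1 / D) with ((D - k * (1 - sin t)) / (D * k))
      by (field; lra).
    apply Rdiv_le_0_compat; nra.
Qed.

(** * Size and doubling of the ring function *)

(** Since [ellK (conj_mod k)] is between [PI / 2] and [PI / 2 / k], one has
    [k * ellK k <= mu (conj_mod k) <= ellK k]. The factor [k] left in the second bound is harmless
    in the limit [k -> 1]. *)
Lemma mu_conj_bounds k : 0 < k < 1 ->
  ln ((1 + k) / conj_mod k) <= mu (conj_mod k)
  /\ k * mu (conj_mod k) <= ln ((1 + k) / conj_mod k) + PI / 2.
Proof.
  intros hk.
  pose proof PI_RGT_0 as hpi.
  pose proof (conj_mod_bounds k hk) as hc.
  pose proof (ellK_bounds _ hc) as hK'.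
  pose proof (ellK_log_bounds k hk) as hK.
  unfold mu; rewrite conj_mod_involutive in * by auto.
  set (L := ln _) in *.
  set (K' := ellK (conj_mod k)) in *.
  assert (hL : L <= k * ellK k <= L + PI / 2).
  { destruct hK as [h1 h2].
    apply Rle_div_l in h1; [| lra].
    replace (L / k + PI / 2 / k) with ((L + PI / 2) / k) in h2 by (field; lra).
    apply Rle_div_r in h2; lra. }
  pose proof (ellK_bounds k hk) as hK0.
  destruct hK' as [h1 h2]; apply Rle_div_r in h2; [| lra].
  split.
  - apply Rle_trans with (k * ellK k); [lra |].
    replace (PI / 2 * (ellK k / K')) with (PI / 2 * ellK k / K') by (field; lra).
    rewrite <- Rle_div_r by lra; nra.
  - apply Rle_trans with (k * ellK k); [| lra].
    apply Rmult_le_compat_l; [lra |].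
    replace (PI / 2 * (ellK k / K')) with (PI / 2 * ellK k / K') by (field; lra).
    rewrite Rle_div_l by lra; nra.
Qed.

(** The numerator is multiplied by [1 + k] (ascending form) and the denominator by [(1 + k) / 2]
    (descending form), so the quotient doubles. *)
Lemma mu_conj_landen_step k : 0 < k < 1 ->
  mu (conj_mod (2 * sqrt k / (1 + k))) = 2 * mu (conj_mod k).
Proof.
  intros hk; unfold mu.
  pose proof PI_RGT_0 as hpi.
  rewrite (conj_mod_involutive k), (conj_mod_involutive (2 * _ / _))
    by (auto; now apply landen_step_bounds).
  rewrite ellK_landen, conj_mod_landen_step, ellK_conj_landen by auto.
  assert (hx : 0 < (1 - k) / (1 + k) < 1).
  { rewrite <- conj_mod_landen_step by auto.
    now apply conj_mod_bounds, landen_step_bounds. }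
  pose proof (ellK_bounds _ hx).
  field; lra.
Qed.

(** * The Landen sequence and its convergence to 1 *)

Lemma landen_bounds r n : 0 < r < 1 -> 0 < landen r n < 1.
Proof.
  intros hr; induction n as [| n IH]; [exact hr | now apply landen_step_bounds].
Qed.

Lemma mu_conj_landen r n : 0 < r < 1 ->
  mu (conj_mod (landen r n)) = 2 ^ n * mu (conj_mod r).
Proof.
  intros hr; induction n as [| n IH]; simpl; [ring |].
  rewrite mu_conj_landen_step, IH by now apply landen_bounds.
  ring.
Qed.

Lemma landen_geometric r n : 0 < r < 1 -> 1 - landen r n <= (1 - r) ^ n.
Proof.
  intros hr.
  (* The induction also carries [r <= landen r n], which makes the contraction ratio [1 - r] uniform
     in [n]. *)
  cut (r <= landen r n /\ 1 - landen r n <= (1 - r) ^ n); [tauto |].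
  induction n as [| n [IH1 IH2]]; simpl; [lra |].
  pose proof (landen_bounds r n hr) as hx.
  set (x := landen r n) in *.
  assert (hs : 0 < sqrt x) by (apply sqrt_lt_R0; lra).
  pose proof (sqrt_sqrt x ltac:(lra)) as hs2.
  assert (hs1 : sqrt x <= 1) by nra.
  assert (hs3 : x <= sqrt x) by nra.
  assert (e : 1 - 2 * sqrt x / (1 + x) = (1 - sqrt x) ^ 2 / (1 + x)).
  { replace ((1 - sqrt x) ^ 2) with (1 - 2 * sqrt x + x) by nra.
    field; lra. }
  assert (hq : 1 - 2 * sqrt x / (1 + x) <= (1 - x) * (1 - r)).
  { rewrite e; apply Rle_div_l; [lra |].
    (* From [r <= x <= sqrt x], one factor [1 - sqrt x] is at most [1 - x] and the other at most
       [1 - r]. *)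
    assert ((1 - sqrt x) ^ 2 <= (1 - x) * (1 - r)) by nra.
    assert (0 <= (1 - x) * (1 - r)) by nra.
    nra. }
  split; nra.
Qed.

Lemma is_lim_seq_landen r : 0 < r < 1 -> is_lim_seq (landen r) 1.
Proof.
  intros hr.
  apply is_lim_seq_le_le with (fun n => 1 - (1 - r) ^ n) (fun _ => 1).
  - intros n; pose proof (landen_geometric r n hr);
      pose proof (landen_bounds r n hr); lra.
  - replace (Finite 1) with (Finite (1 - 0)) by (f_equal; ring).
    apply is_lim_seq_minus'; [apply is_lim_seq_const |].
    apply is_lim_seq_geom; rewrite Rabs_pos_eq; lra.
  - apply is_lim_seq_const.
Qed.

(** * The infinite product and its value *)

(** In logarithms each factor is a difference of consecutive terms [ln s_n / 2 ^ n], with [s_n]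
    conjugate to [landen r n]. The index [S N] appears because there are [N + 1] factors. *)
Lemma landen_partial_telescope r N : 0 < r < 1 ->
  landen_partial r N =
  conj_mod r * exp (- ln (conj_mod (landen r (S N))) / 2 ^ S N).
Proof.
  intros hr.
  assert (hstep : forall n, ln (1 + landen r n) / 2 ^ n =
    ln (conj_mod (landen r n)) / 2 ^ n
    - ln (conj_mod (landen r (S n))) / 2 ^ S n).
  { intros n; simpl landen; simpl pow.
    pose proof (landen_bounds r n hr) as hx.
    set (x := landen r n) in *.
    pose proof (conj_mod_bounds x hx) as hc.
    rewrite conj_mod_landen_step, ln_div by lra.
    (* The logarithm of [s_n ^ 2 = (1 - r_n) * (1 + r_n)], to be combined with
       [s_(n+1) = (1 - r_n) / (1 + r_n)]. *)
    assert (h : 2 * ln (conj_mod x) = ln (1 - x) + ln (1 + x)).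
    { rewrite <- ln_mult by lra.
      replace ((1 - x) * (1 + x)) with (conj_mod x * conj_mod x).
      - rewrite ln_mult by lra; ring.
      - pose proof (conj_mod_sq x hx); nra. }
    assert (h2 : 2 ^ n <> 0) by (apply pow_nonzero; lra).
    replace (ln (conj_mod x)) with ((ln (1 - x) + ln (1 + x)) / 2) by lra.
    field; exact h2. }
  assert (hf : forall n, Rpower (1 + landen r n) (/ 2 ^ n) =
    exp (ln (conj_mod (landen r n)) / 2 ^ n
         - ln (conj_mod (landen r (S n))) / 2 ^ S n)).
  { intros n; rewrite <- hstep; unfold Rpower; f_equal.
    field; apply pow_nonzero; lra. }
  unfold landen_partial; induction N as [| N IH]; cbn [prod_f_R0].
  - pose proof (hf 0%nat) as h0; simpl in h0 |- *; rewrite h0.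
    unfold Rminus; rewrite exp_plus; unfold Rdiv at 1.
    rewrite Rinv_1, Rmult_1_r, exp_ln by now apply conj_mod_bounds.
    do 2 f_equal; field.
  - rewrite IH, (hf (S N)), Rmult_assoc, <- exp_plus.
    do 2 f_equal; unfold Rdiv; ring.
Qed.

Lemma is_lim_seq_ln_conj_landen r : 0 < r < 1 ->
  is_lim_seq (fun n => - ln (conj_mod (landen r n)) / 2 ^ n) (mu (conj_mod r)).
Proof.
  intros hr.
  (* [C] bounds the error terms [ln (1 + landen r n)] and [PI / 2] together; division by [2 ^ n]
     makes it vanish in the limit. *)
  set (C := ln 2 + PI / 2).
  apply is_lim_seq_le_le with
    (fun n => landen r n * mu (conj_mod r) - C * (/ 2) ^ n)
    (fun _ => mu (conj_mod r)).
  - intros n.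
    pose proof (landen_bounds r n hr) as hx.
    destruct (mu_conj_bounds _ hx) as [hlo hup].
    rewrite mu_conj_landen in hlo, hup by auto.
    pose proof (conj_mod_bounds _ hx) as hc.
    rewrite ln_div in hlo, hup by lra.
    assert (h0 : 0 < ln (1 + landen r n)) by (rewrite <- ln_1; apply ln_increasing; lra).
    assert (h1 : ln (1 + landen r n) < ln 2) by (apply ln_increasing; lra).
    assert (hp : 0 < 2 ^ n) by (apply pow_lt; lra).
    split; [apply Rle_div_r; [lra |] | apply Rle_div_l; lra].
    rewrite pow_inv, Rmult_minus_distr_r.
    replace (C * / 2 ^ n * 2 ^ n) with C by (field; lra).
    unfold C; lra.
  - replace (Finite (mu (conj_mod r)))
      with (Finite (1 * mu (conj_mod r) - C * 0)) by (f_equal; ring).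
    apply is_lim_seq_minus'.
    + apply is_lim_seq_mult'; [now apply is_lim_seq_landen | apply is_lim_seq_const].
    + apply is_lim_seq_mult'; [apply is_lim_seq_const |].
      apply is_lim_seq_geom; rewrite Rabs_pos_eq; lra.
  - apply is_lim_seq_const.
Qed.

Lemma is_lim_seq_landen_partial r : 0 < r < 1 ->
  is_lim_seq (landen_partial r) (conj_mod r * exp (mu (conj_mod r))).
Proof.
  intros hr.
  apply is_lim_seq_ext with
    (fun N => conj_mod r * exp (- ln (conj_mod (landen r (S N))) / 2 ^ S N)).
  { intros N; now rewrite landen_partial_telescope. }
  apply is_lim_seq_mult'; [apply is_lim_seq_const |].
  apply (is_lim_seq_continuous exp).
  - apply derivable_continuous_pt, derivable_pt_exp.
  - apply (is_lim_seq_incr_1 (fun n => - ln (conj_mod (landen r n)) / 2 ^ n)).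
    now apply is_lim_seq_ln_conj_landen.
Qed.

Lemma landen_prod_eq r : 0 < r < 1 ->
  landen_prod r = conj_mod r * exp (mu (conj_mod r)).
Proof.
  intros hr; unfold landen_prod.
  now rewrite (is_lim_seq_unique _ _ (is_lim_seq_landen_partial r hr)).
Qed.

Lemma G_eq r : 0 < r < 1 ->
  G r = ln (r * conj_mod r) + mu r + mu (conj_mod r).
Proof.
  intros hr; unfold G.
  pose proof (conj_mod_bounds r hr) as hc.
  rewrite landen_prod_eq, !ln_mult, ln_exp by (try apply exp_pos; lra).
  ring.
Qed.

Theorem theorem1 (r : R) (hr : 0 < r < 1) :
  ex_finite_lim_seq (landen_partial r) /\
  landen_prod r = conj_mod r * exp (mu (conj_mod r)) /\
  G r = ln (r * conj_mod r) + mu r + mu (conj_mod r) /\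
  ln (r * conj_mod r) + mu r + mu (conj_mod r) = G (conj_mod r).
Proof.
  split; [| split; [| split]].
  - eexists; now apply is_lim_seq_landen_partial.
  - now apply landen_prod_eq.
  - now apply G_eq.
  (* The closed form of [G] is invariant under exchanging [r] and [conj_mod r]. *)
  - rewrite G_eq, conj_mod_involutive, (Rmult_comm r) by (auto; now apply conj_mod_bounds).
    ring.
Qed.
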